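(* (i) Let $\mathcal{G}$ be a graph that admits an adapted complex structure $J$, and let $\mathcal{G}_b=(p_1,p_2,p_3)$ be the corresponding basic subgraph. If $p_1=0$ and $\mathcal{G}$ is not basic, then the girth of $\mathcal{G}$ is $3$. (ii) For each $n\in\mathbb{N}$, $n\geq 3$, there exists a connected graph $\mathcal{G}$ with an adapted complex structure $J$ whose corresponding basic subgraph $\mathcal{G}_b=(p_1,p_2,p_3)$ satisfies $p_2=p_3=0$ and such that the girth of $\mathcal{G}$ is $n$.
   Context: Graphs are finite and simple. The girth of a graph is the length of a shortest cycle contained in it (infinite if there are no cycles). For a graph $\mathcal{G}=(V,E)$ label $V=\{v_1,\dots,v_N\}$ and write $e_{i,j}$ ($i<j$) for the edge joining $v_i$ and $v_j$, if it exists. The Lie algebra $\mathfrak{n}_{\mathcal{G}}$ is the real vector space with basis $V\cup E$ and Lie bracket $[v_i,v_j]=e_{i,j}$ for $i<j$ if $v_i,v_j$ are adjacent, $[v_i,v_j]=0$ if they are not adjacent, and all elements of $E$ central. A complex structure on a real Lie algebra $\mathfrak{g}$ is a linear map $J:\mathfrak{g}\to\mathfrak{g}$ with $J^2=-\mathrm{Id}$ and $[x,y]+J([Jx,y]+[x,Jy])-[Jx,Jy]=0$ for all $x,y\in\mathfrak{g}$. An adapted complex structure on the graph $\mathcal{G}$ is a complex structure $J$ on $\mathfrak{n}_{\mathcal{G}}$ such that for every $x\in V\cup E$ either $Jx\in V\cup E$ or $-Jx\in V\cup E$. An edge is distinguished if it joins a pair of vertices $v,w$ with $w=Jv$. A graph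 is basic if it is a disjoint union of copies of: $\mathbb{A}_1$ (two vertices, no edges), $\mathbb{A}_2$ (three vertices and exactly one edge), $\mathbb{A}_3$ (four vertices and exactly two edges, which share no vertex). Corresponding (associated) basic subgraph: $\mathcal{G}_b$ is the spanning subgraph of $\mathcal{G}$ (same vertices) whose edges are exactly the distinguished edges of $(\mathcal{G},J)$. It is $J$-invariant (up to sign) and decomposes as a disjoint union of $J$-invariant subgraphs of the following types: $\mathbb{A}_1$ (two vertices $v,\pm Jv$, no edge); $\mathbb{A}_2$ (an edge $\overline{v\,w}$ with $w=Jv$, together with one further vertex $u$ with $\pm Ju=\overline{v\,w}$); $\mathbb{A}_3$ (two disjoint edges $a$, $\pm Ja$, each of the form $\overline{v\,w}$ with $w=Jv$). The notation $\mathcal{G}_b=(p_1,p_2,p_3)$ means that there are $p_i$ copies of $\mathbb{A}_i$, $i=1,2,3$, in this decomposition. *)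

(* Defs.v *)
From HB Require Import structures.
From mathcomp Require Import all_boot all_order all_algebra.
From mathcomp Require Import boolp reals.

Set Implicit Arguments.
Unset Strict Implicit.
Unset Printing Implicit Defensive.

Import Order.TTheory GRing.Theory Num.Theory.
Local Open Scope ring_scope.

Record sgraph := SGraph {
  nvert : nat;
  adj : rel 'I_nvert;
  adj_sym : symmetric adj;
  adj_irr : irreflexive adj }.

Definition vertex (G : sgraph) : finType := 'I_(nvert G).

Definition gconnected (G : sgraph) : Prop :=
  (0 < nvert G)%N /\ forall v w : vertex G, connect (@adj G) v w.

Definition has_cycle (G : sgraph) (k : nat) : bool :=
  [exists c : k.-tuple (vertex G), (2 < k)%N && ucycleb (@adj G) c].

(* [None] stands for infinite girth. *)
Definition girth (G : sgraph) : option nat :=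
  match pselect (exists k, has_cycle G k) with
  | left ex_cycle => Some (ex_minn ex_cycle)
  | right _ => None
  end.

(* The edge joining v_i and v_j is the pair (i, j) with i < j. *)
Definition is_edge (G : sgraph) (p : vertex G * vertex G) : bool :=
  (p.1 < p.2)%N && adj p.1 p.2.

Definition edge (G : sgraph) : finType := {p : vertex G * vertex G | is_edge p}.

Definition joins (G : sgraph) (f : edge G) (v w : vertex G) : bool :=
  (val f == (v, w)) || (val f == (w, v)).

Section Explicit_graph.
Variables (n : nat) (s : seq (nat * nat)).

Definition seq_adj : rel 'I_n :=
  fun i j => (i != j) &&
    (((i : nat, j : nat) \in s) || ((j : nat, i : nat) \in s)).

Lemma seq_adj_sym : symmetric seq_adj.
Proof. by move=> i j; rewrite /seq_adj eq_sym orbC. Qed.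

Lemma seq_adj_irr : irreflexive seq_adj.
Proof. by move=> i; rewrite /seq_adj eqxx. Qed.

Definition seq_graph : sgraph := SGraph seq_adj_sym seq_adj_irr.
End Explicit_graph.

Definition graph_A1 : sgraph := seq_graph 2 [::].
Definition graph_A2 : sgraph := seq_graph 3 [:: (0, 1)]%N.
Definition graph_A3 : sgraph := seq_graph 4 [:: (0, 1); (2, 3)]%N.

(* The subgraph of G induced on B is isomorphic to H. *)
Definition induces_copy (H G : sgraph) (B : {set vertex G}) : Prop :=
  exists h : vertex H -> vertex G,
    [/\ injective h,
        B = [set h i | i in [set: vertex H]]
      & forall i j, adj (h i) (h j) = adj i j].

(* P is the family of vertex sets of the copies; P = set0 gives the empty
   graph, the disjoint union of no copies. *)
Definition basic (G : sgraph) : Prop :=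
  exists P : {set {set vertex G}},
    [/\ partition P [set: vertex G],
        (forall v w, adj v w -> pblock P v = pblock P w)
      & forall B, B \in P ->
          [\/ induces_copy graph_A1 B,
              induces_copy graph_A2 B
            | induces_copy graph_A3 B]].

Definition basis_index (G : sgraph) : finType := (vertex G + edge G)%type.

(* The underlying vector space of n_G, with basis V u E. *)
Definition lie (R : realType) (G : sgraph) := {ffun basis_index G -> R^o}.

Definition bvec (R : realType) (G : sgraph) (b : basis_index G) : lie R G :=
  [ffun c => (c == b)%:R].

Definition vvec (R : realType) (G : sgraph) (v : vertex G) : lie R G :=
  bvec R (inl v).

Definition evec (R : realType) (G : sgraph) (f : edge G) : lie R G :=
  bvec R (inr f).

(* e_{i,j} if i < j and v_i, v_j are adjacent, 0 otherwise. *)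
Definition edge_or0 (R : realType) (G : sgraph) (i j : vertex G) : lie R G :=
  oapp (@evec R G) 0 (insub (i, j)).

(* Antisymmetrized, so that [v_j, v_i] = - e_{i,j} for i < j. *)
Definition basis_bracket (R : realType) (G : sgraph) (a b : basis_index G) :
    lie R G :=
  match a, b with
  | inl i, inl j => edge_or0 R i j - edge_or0 R j i
  | _, _ => 0
  end.

Definition bracket (R : realType) (G : sgraph) (x y : lie R G) : lie R G :=
  \sum_a \sum_b (x a * y b) *: basis_bracket R a b.

Definition complex_structure (R : realType) (G : sgraph)
    (J : {linear lie R G -> lie R G}) : Prop :=
  (forall x, J (J x) = - x) /\
  (forall x y,
     bracket x y + J (bracket (J x) y + bracket x (J y))
       - bracket (J x) (J y) = 0).

Definition adapted_complex_structure (R : realType) (G : sgraph)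
    (J : {linear lie R G -> lie R G}) : Prop :=
  complex_structure J /\
  forall a, exists b, J (bvec R a) = bvec R b \/ - J (bvec R a) = bvec R b.

Section Basic_subgraph.
Variables (R : realType) (G : sgraph) (J : {linear lie R G -> lie R G}).

Definition eq_upto_sign (x y : lie R G) : bool := (x == y) || (x == - y).

Definition distinguished (f : edge G) : bool :=
  [exists v, exists w, joins f v w && (vvec R w == J (vvec R v))].

Definition basic_subgraph_adj : rel (vertex G) :=
  fun v w => [exists f, joins f v w && distinguished f].

Lemma basic_subgraph_adj_sym : symmetric basic_subgraph_adj.
Proof.
by move=> v w; apply: eq_existsb => f; rewrite /joins orbC.
Qed.

Lemma basic_subgraph_adj_irr : irreflexive basic_subgraph_adj.
Proof.
move=> v; apply/existsP => -[f /andP[]]; rewrite /joins orbb => /eqP fE _.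
by have := valP f; rewrite fE /is_edge adj_irr andbF.
Qed.

Definition basic_subgraph : sgraph :=
  SGraph basic_subgraph_adj_sym basic_subgraph_adj_irr.

(* The J-invariant summands A_i of [basic_subgraph], identified with their vertex
   sets (not its connected components).  An edge of G joining v and w = J v is an edge of [basic_subgraph]. *)
Definition pieces_A1 : {set {set vertex G}} :=
  [set B : {set vertex G} | [exists v : vertex G, exists w : vertex G,
    [&& B == [set v; w], v != w,
        eq_upto_sign (J (vvec R v)) (vvec R w)
      & ~~ @adj basic_subgraph v w]]].

Definition pieces_A2 : {set {set vertex G}} :=
  [set B : {set vertex G} | [exists v : vertex G, exists w : vertex G,
    exists u : vertex G, exists f : edge G,
    [&& B == [set v; w; u], uniq [:: v; w; u],
        joins f v w, vvec R w == J (vvec R v)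
      & eq_upto_sign (J (vvec R u)) (evec R f)]]].

Definition pieces_A3 : {set {set vertex G}} :=
  [set B : {set vertex G} | [exists v : vertex G, exists w : vertex G,
    exists v' : vertex G, exists w' : vertex G,
    exists f : edge G, exists f' : edge G,
    [&& B == [set v; w; v'; w'], uniq [:: v; w; v'; w'],
        joins f v w && (vvec R w == J (vvec R v)),
        joins f' v' w' && (vvec R w' == J (vvec R v'))
      & eq_upto_sign (J (evec R f)) (evec R f')]]].

Definition basic_subgraph_type : nat * nat * nat :=
  (#|pieces_A1|, #|pieces_A2|, #|pieces_A3|).
End Basic_subgraph.

(* Main.v *)
(** An adapted J acts on the basis as a signed permutation, with underlying fixed-point-free
    involution sigma. Read at the coordinate of an edge pq with sigma p <> q, integrability
    forces (sigma p, q) or (p, sigma q) to be a pair of adjacent vertices. If p1 = 0, every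
    vertex v with sigma v a vertex is adjacent to sigma v, so such an edge pq lies in a
    triangle; if there is no such edge, the pairs {f, sigma f}, for f distinguished,
    partition the graph into copies of A_2 and A_3.
    For girth n, take an n-cycle v_0, ..., v_(n-1) with one pendant vertex w_(i+1) at each
    v_i, and J v_i = w_i, J [v_i, v_(i+1)] = [v_i, w_(i+1)]. *)

Require Import Defs.
From mathcomp Require Import all_boot all_order all_algebra.
From mathcomp Require Import boolp reals.
From HB Require Import structures.
From mathcomp Require Import ring zify.

Set Implicit Arguments.
Unset Strict Implicit.
Unset Printing Implicit Defensive.

Import Order.TTheory GRing.Theory Num.Theory.
Local Open Scope ring_scope.

(** * Coordinates of basis vectors and of the bracket *)

Section Coordinates.
Variables (R : realType) (G : sgraph).
Implicit Types (x y : lie R G) (b c : basis_index G) (f : edge G).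

Lemma bvecE b c : bvec R b c = (c == b)%:R.
Proof. by rewrite ffunE. Qed.

Lemma signed_bvec_eq (t : bool) b c :
  ((-1) ^+ t *: bvec R b == bvec R c) = ~~ t && (b == c).
Proof.
apply/eqP/andP => [/ffunP/(_ c)|[/negbTE-> /eqP->]]; last by rewrite scale1r.
rewrite ffunE !bvecE eqxx eq_sym scaler_sign.
case: t; case: eqP => // _; rewrite ?oppr0 => /eqP.
- by rewrite -subr_eq0 -opprD oppr_eq0 (pnatr_eq0 _ 2).
- by rewrite eq_sym oner_eq0.
- by rewrite eq_sym oner_eq0.
Qed.

Lemma edge_or0_inl (i j v : vertex G) : edge_or0 R i j (inl v) = 0.
Proof. by rewrite /edge_or0; case: insubP => [g _ _|_] /=; rewrite ffunE. Qed.

Lemma edge_or0_inr (i j : vertex G) f : edge_or0 R i j (inr f) = (val f == (i, j))%:R.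
Proof.
rewrite /edge_or0; case: insubP => [g _ <-|nE] /=; first by rewrite bvecE.
by rewrite ffunE; case: eqP nE => // <-; rewrite (valP f).
Qed.

Lemma bracket_inl x y v : bracket x y (inl v) = 0.
Proof.
rewrite sum_ffunE big1 // => a _; rewrite sum_ffunE big1 // => b _.
case: a b => [i|?] [j|?] /=.
  by rewrite 3!ffunE !edge_or0_inl subr0 scaler0.
all: by rewrite !ffunE scaler0.
Qed.

(** Only the index pairs (i, j) and (j, i) reach the coordinate at e_{i,j}, and they enter with
    opposite signs. The result is a 2x2 minor of vertex coordinates, to which all integrability
    checks reduce. *)
Lemma bracket_inr x y f :
  bracket x y (inr f) =
    x (inl (val f).1) * y (inl (val f).2) - x (inl (val f).2) * y (inl (val f).1).
Proof.
case fE: (val f) => [i j] /=.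
have sum_delta k l : \sum_a \sum_b x (inl a) * y (inl b) * ((k, l) == (a, b))%:R
    = x (inl k) * y (inl l).
  rewrite (bigD1 k) //= (bigD1 l) //= eqxx mulr1.
  rewrite big1 ?addr0 => [|b]; last by rewrite xpair_eqE eq_sym => /negbTE->; rewrite andbF mulr0.
  rewrite big1 ?addr0 // => a; rewrite eq_sym => /negbTE aF.
  by rewrite big1 // => b _; rewrite xpair_eqE aF mulr0.
rewrite sum_ffunE big_sumType /= [X in _ + X]big1 ?addr0; last first.
  move=> a _; rewrite sum_ffunE big1 // => b _.
  by rewrite !ffunE scaler0.
transitivity (\sum_a \sum_b (x (inl a) * y (inl b) * ((i, j) == (a, b))%:R -
   x (inl a) * y (inl b) * ((i, j) == (b, a))%:R)).
  apply: eq_bigr => a _; rewrite sum_ffunE big_sumType /= [X in _ + X]big1 ?addr0.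
    by apply: eq_bigr => b _; rewrite !ffunE !edge_or0_inr fE -mulrBr.
  by move=> b _; rewrite !ffunE scaler0.
rewrite -(sum_delta i j) -(sum_delta j i) -sumrB.
apply: eq_bigr => a _; rewrite -sumrB; apply: eq_bigr => b _.
by rewrite !xpair_eqE [(j == a) && _]andbC.
Qed.

End Coordinates.

(** * Signed permutations of the basis and adapted complex structures *)

Section SignedPermutation.
Variables (R : realType) (G : sgraph).
Variables (sigma : basis_index G -> basis_index G) (s : basis_index G -> bool).

(** The sign is indexed by the output coordinate, so basis vector [b] picks up the sign at
    [sigma b], not at [b]. *)
Definition signed_perm (x : lie R G) : lie R G :=
  [ffun c => (-1) ^+ s c * x (sigma c)].

Lemma signed_perm_is_linear : linear signed_perm.
Proof.
move=> a x y; apply/ffunP => c; rewrite !ffunE mulrDr.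
by congr (_ + _); rewrite /GRing.scale /= mulrCA.
Qed.

HB.instance Definition _ :=
  GRing.isLinear.Build R (lie R G) (lie R G) _ signed_perm signed_perm_is_linear.

Hypothesis sigmaK : involutive sigma.

Lemma signed_perm_bvec b :
  signed_perm (bvec R b) = (-1) ^+ s (sigma b) *: bvec R (sigma b).
Proof.
apply/ffunP => c; rewrite ffunE [in RHS]ffunE !bvecE (can2_eq sigmaK sigmaK).
by case: eqP => [->|_]; rewrite ?mulr0 ?scaler0.
Qed.

Hypothesis sK : forall c, s (sigma c) = ~~ s c.

Lemma signed_permK x : signed_perm (signed_perm x) = - x.
Proof.
apply/ffunP => c; rewrite !ffunE sigmaK sK mulrA -signr_addb.
by rewrite addbN addbb mulN1r.
Qed.

End SignedPermutation.

Lemma adapted_signed_perm (R : realType) (G : sgraph)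
    (J : {linear lie R G -> lie R G}) :
  adapted_complex_structure J ->
  exists sigma s, [/\ involutive sigma, forall c, s (sigma c) = ~~ s c
    & J =1 signed_perm sigma s].
Proof.
move=> [[JJ _] adJ].
have /choice[sg sgE] : forall a, exists p : basis_index G * bool,
    J (bvec R a) = (-1) ^+ p.2 *: bvec R p.1.
  move=> a; have [b [E|E]] := adJ a.
    by exists (b, false); rewrite scale1r.
  by exists (b, true); rewrite scaleN1r -E opprK.
(* [sg] records signs by input vector, [s] by output coordinate; hence the shift by [sigma]. *)
pose sigma a := (sg a).1; pose s a := (sg (sigma a)).2.
(* The summand [true] absorbs the minus sign of J^2 = -1, so that index and sign can be read off
   separately. *)
have JJb a : (-1) ^+ ((sg a).2 (+) s a (+) true) *: bvec R (sigma (sigma a)) = bvec R a.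
  rewrite addbT -[RHS]opprK -(JJ (bvec R a)) sgE linearZ /= sgE.
  by rewrite scalerA -signr_addb signrN scaleNr.
have {}JJb a : ((sg a).2 (+) s a) && (sigma (sigma a) == a).
  by have /eqP := JJb a; rewrite signed_bvec_eq addbT negbK.
have sigmaK : involutive sigma by move=> a; apply/eqP; case/andP: (JJb a).
have sK c : s (sigma c) = ~~ s c.
  have /andP[/addbP <- _] := JJb c.
  by rewrite /s sigmaK negbK.
exists sigma, s; split=> // x.
have xE : x = \sum_b x b *: bvec R b.
  apply/ffunP => c; rewrite sum_ffunE (bigD1 c) //= big1 => [|b bc].
    by rewrite ffunE bvecE eqxx addr0 /GRing.scale /= mulr1.
  by rewrite ffunE bvecE eq_sym (negbTE bc) scaler0.
rewrite {1}xE linear_sum; apply/ffunP => c; rewrite sum_ffunE (bigD1 (sigma c)) //= big1.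
  by rewrite linearZ /= sgE !ffunE -/(sigma _) sigmaK eqxx addr0 /GRing.scale /= mulr1 mulrC.
move=> b bc; rewrite linearZ /= sgE !ffunE -/(sigma _).
by rewrite -(can2_eq sigmaK sigmaK) eq_sym (negbTE bc) !scaler0.
Qed.

Lemma bracket_bvec_neq0 (R : realType) (G : sgraph) (a b : basis_index G) (f : edge G) :
  bracket (bvec R a) (bvec R b) (inr f) != 0 ->
  exists p q, [/\ a = inl p, b = inl q & adj p q].
Proof.
rewrite bracket_inr !bvecE; case fE: (val f) => [p q] /=.
have /andP[_ /= pq] : is_edge (p, q) by rewrite -fE (valP f).
rewrite -!natrM !mulnb; have [/andP[/eqP<- /eqP<-] _|_] := boolP (_ && _).
  by exists p, q.
rewrite sub0r oppr_eq0; have [/andP[/eqP<- /eqP<-] _|_] := boolP (_ && _).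
  by exists q, p; rewrite adj_sym.
by rewrite eqxx.
Qed.

Lemma bracketZl_inr (R : realType) (G : sgraph) (t : R) (x y : lie R G) (f : edge G) :
  bracket (t *: x) y (inr f) = t * bracket x y (inr f).
Proof. by rewrite !bracket_inr !ffunE mulrBr /GRing.scale /= !mulrA. Qed.

Lemma bracketZr_inr (R : realType) (G : sgraph) (t : R) (x y : lie R G) (f : edge G) :
  bracket x (t *: y) (inr f) = t * bracket x y (inr f).
Proof. by rewrite !bracket_inr !ffunE mulrBr /GRing.scale /= ![t * (_ * _)]mulrCA. Qed.

(** * Girth, edges and induced copies *)

Lemma girth_eq (G : sgraph) (n : nat) :
  has_cycle G n -> (forall k, has_cycle G k -> (n <= k)%N) -> girth G = Some n.
Proof.
move=> cn min_n; rewrite /girth; case: pselect => [exc|[]]; last by exists n.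
by case: ex_minnP => m /min_n nm /(_ _ cn) mn; congr Some; apply/eqP; rewrite eqn_leq mn.
Qed.

Lemma triangle_girth (G : sgraph) (u v w : vertex G) :
  adj u v -> adj v w -> adj w u -> girth G = Some 3%N.
Proof.
move=> uv vw wu; apply: girth_eq => [|k /existsP[c /andP[]] //].
apply/existsP; exists [tuple u; v; w]; rewrite /= /ucycleb /= uv vw wu /=.
rewrite !inE negb_or !andbT; apply/andP; split; first (apply/andP; split).
- by apply: contraTneq uv => ->; rewrite adj_irr.
- by apply: contraTneq wu => ->; rewrite adj_irr.
- by apply: contraTneq vw => ->; rewrite adj_irr.
Qed.

Lemma edge_of_adj (G : sgraph) (v w : vertex G) :
  adj v w -> exists f : edge G, joins f v w.
Proof.
move=> vw; case: (ltngtP v w) => [vlw|wlv|/val_inj vE].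
- by exists (exist _ (v, w) (introT andP (conj vlw vw))); rewrite /joins eqxx.
- have wv : adj w v by rewrite adj_sym.
  by exists (exist _ (w, v) (introT andP (conj wlv wv))); rewrite /joins eqxx orbT.
- by rewrite vE adj_irr in vw.
Qed.

Lemma joinsC (G : sgraph) (f : edge G) v w : joins f v w = joins f w v.
Proof. by rewrite /joins orbC. Qed.

Lemma joins_adj (G : sgraph) (f : edge G) v w : joins f v w -> adj v w.
Proof.
by case/orP=> /eqP fE; have := valP f; rewrite fE => /andP[_ /=] //; rewrite adj_sym.
Qed.

Lemma exists_joins (G : sgraph) (f : edge G) : exists v w, joins f v w.
Proof. by exists (val f).1, (val f).2; rewrite /joins -surjective_pairing eqxx. Qed.

Lemma joins_inj (G : sgraph) (f g : edge G) v w : joins f v w -> joins g v w -> f = g.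
Proof.
move=> /orP fE /orP gE; apply: val_inj; have := valP f; have := valP g.
case: fE gE => /eqP-> [] /eqP-> // /andP[/= vw _] /andP[/= wv _];
  by have := ltn_trans vw wv; rewrite ltnn.
Qed.

Lemma joins_mem (G : sgraph) (f : edge G) v w x y :
  joins f v w -> joins f x y -> (x == v) || (x == w).
Proof.
by rewrite /joins => /orP[] /eqP-> /orP[] /eqP[-> ->]; rewrite eqxx ?orbT.
Qed.

(** An enumeration of [B] serves as the isomorphism, which turns the recognition of A_2 and A_3 into
    a finite table of adjacencies. *)
Lemma induces_copy_seq (n : nat) (l : seq (nat * nat)) (G : sgraph)
    (x0 : vertex G) (s : seq (vertex G)) (B : {set vertex G}) :
  B =i s -> uniq s -> size s = n ->
  (forall i j : 'I_n, adj (nth x0 s i) (nth x0 s j) = seq_adj l i j) ->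
  induces_copy (seq_graph n l) B.
Proof.
move=> Bs us sn adjE; exists (fun i : 'I_n => nth x0 s i); split=> //.
- by move=> i j /eqP; rewrite nth_uniq ?sn // => /eqP/val_inj.
- apply/setP => y; rewrite Bs; apply/(nthP x0)/imsetP => [[i]|[i _ ->]].
    by rewrite sn => ilt <-; exists (Ordinal ilt).
  by exists i; rewrite ?sn.
Qed.

Lemma inl_nth_eq (G : sgraph) (x0 : vertex G) (s : seq (vertex G)) (i j : nat) :
  uniq s -> (i < size s)%N -> (j < size s)%N ->
  (inl (nth x0 s i) == inl (nth x0 s j) :> basis_index G) = (i == j).
Proof. by move=> us ? ?; rewrite (inj_eq (@inl_inj _ _)) nth_uniq. Qed.

(** * What integrability says about the graph *)

Section SignedPermutationTheory.
Variables (R : realType) (G : sgraph) (J : {linear lie R G -> lie R G}).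
Variables (sigma : basis_index G -> basis_index G) (s : basis_index G -> bool).
Hypothesis sigmaK : involutive sigma.
Hypothesis sK : forall c, s (sigma c) = ~~ s c.
Hypothesis JE : J =1 signed_perm sigma s.

Lemma sigma_neq c : sigma c != c.
Proof. by apply/negP => /eqP cE; have := sK c; rewrite cE; case: (s c). Qed.

(** At the coordinate of the edge pq, [p, q] contributes 1, and [Jp, Jq] contributes 0 because
    [sigma] sends p neither to p nor to q. So J([Jp, q] + [p, Jq]) is nonzero there, and one of
    these two brackets is nonzero. *)
Lemma sigma_adj (p q : vertex G) : complex_structure J ->
  adj p q -> sigma (inl p) != inl q ->
  (exists2 p', sigma (inl p) = inl p' & adj p' q) \/
  (exists2 q', sigma (inl q) = inl q' & adj p q').
Proof.
move=> [_ intJ]; wlog: p q / (p < q)%N => [W pq|plq pq spq].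
  case: (ltngtP p q) => [plq|qlp|/val_inj pE]; first exact: W.
  - rewrite (can2_eq sigmaK sigmaK) eq_sym => sqp.
    have [|//|[q' qE aq]|[p' pE ap]] := W _ _ qlp; first by rewrite adj_sym.
      by right; exists q' => //; rewrite adj_sym.
    by left; exists p' => //; rewrite adj_sym.
  - by rewrite pE adj_irr in pq.
pose f : edge G := exist _ (p, q) (introT andP (conj plq pq)).
have xJy : bracket (J (bvec R (inl p))) (J (bvec R (inl q))) (inr f) = 0.
  rewrite !JE !signed_perm_bvec // bracketZl_inr bracketZr_inr bracket_inr /= !bvecE.
  rewrite [inl p == _]eq_sym (negbTE (sigma_neq _)) [inl q == sigma (inl p)]eq_sym (negbTE spq).
  by rewrite !mul0r subr0 !mulr0.
have xy : bracket (bvec R (inl p)) (bvec R (inl q)) (inr f) = 1.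
  rewrite bracket_inr /= !bvecE !eqxx mulr1.
  have /negbTE-> : inl q != inl p :> basis_index G
    by apply/eqP => -[qp]; have := plq; rewrite qp ltnn.
  by rewrite mul0r subr0.
have /ffunP/(_ (inr f)) := intJ (bvec R (inl p)) (bvec R (inl q)).
rewrite !ffunE xJy xy subr0 (JE (_ + _)) ffunE.
(* The coordinate of J(...) at [f] is, up to sign, the one at [sigma (inr f)]. If that is a vertex,
   both brackets vanish there and the equation reads 1 = 0. *)
case: (sigma (inr f)) => [u|g].
  by rewrite ffunE !bracket_inl addr0 mulr0 addr0 => /eqP; rewrite oner_eq0.
have [/bracket_bvec_neq0|/negPn/eqP lE] :=
  boolP (bracket (bvec R (sigma (inl p))) (bvec R (inl q)) (inr g) != 0).
  by case=> p' [q' [-> [->] ?]] _; left; exists p'.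
have [/bracket_bvec_neq0|/negPn/eqP rE] :=
  boolP (bracket (bvec R (inl p)) (bvec R (sigma (inl q))) (inr g) != 0).
  by case=> p' [q' [[->] -> ?]] _; right; exists q'.
rewrite ffunE !JE !signed_perm_bvec // bracketZl_inr bracketZr_inr lE rE.
by rewrite !mulr0 addr0 mulr0 addr0 => /eqP; rewrite oner_eq0.
Qed.

Lemma eq_upto_sign_sigma v w : sigma (inl v) = inl w ->
  eq_upto_sign (J (vvec R v)) (vvec R w).
Proof.
move=> vw; rewrite /eq_upto_sign JE signed_perm_bvec // vw.
by case: (s _); rewrite ?scale1r ?scaleN1r ?eqxx ?orbT.
Qed.

Lemma sigma_of_J v w : vvec R w = J (vvec R v) -> sigma (inl v) = inl w.
Proof.
by rewrite JE signed_perm_bvec // => /esym/eqP; rewrite signed_bvec_eq => /andP[_ /eqP].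
Qed.

(** If [v] and its mate were not adjacent in [G], neither would they be in the basic subgraph, and
    together they would form an A_1 piece. *)
Lemma pieces_A1_eq0 v w :
  pieces_A1 J = set0 -> sigma (inl v) = inl w -> adj v w.
Proof.
move=> /setP/(_ [set v; w]) + vw; rewrite !inE => /negbT; apply: contraNT => vNw.
apply/existsP; exists v; apply/existsP; exists w; rewrite eqxx /=.
have -> : v != w.
  by apply/eqP => vE; have := sigma_neq (inl v); rewrite vw -vE eqxx.
rewrite eq_upto_sign_sigma //=; apply: contra vNw.
by case/existsP=> f /andP[/joins_adj].
Qed.

(** * Graphs whose edges are exactly the pairs of mates are basic *)

Section Basic.
Hypothesis adj_sigma : forall v w : vertex G, adj v w = (sigma (inl v) == inl w).

Lemma exists_mate_edge v : exists f : edge G, sigma (inl v) = inr f \/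
  exists2 w, sigma (inl v) = inl w & joins f v w.
Proof.
case vE: (sigma (inl v)) => [w|f]; last by exists f; left.
have /edge_of_adj[f fvw] : adj v w by rewrite adj_sigma vE.
by exists f; right; exists w.
Qed.

Lemma all_distinguished_basic : basic G.
Proof.
(* [e v] is the edge of the piece of [v], and [K v] the J-orbit of that edge up to sign. *)
have /choice[e eP] := exists_mate_edge.
have e_joins f v w : joins f v w -> e v = f.
  move=> fvw; have := joins_adj fvw; rewrite adj_sigma => /eqP vw.
  have := eP v; rewrite vw => -[//|[x [<-] evw]]; exact: joins_inj evw fvw.
have e_vertex f u : sigma (inl u) = inr f -> e u = f.
  by move=> uf; have := eP u; rewrite uf => -[[//]|[]].
pose K v : {set basis_index G} := [set inr (e v); sigma (inr (e v))].
have Kend f v w : joins f v w -> K v = [set inr f; sigma (inr f)].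
  by rewrite /K => /e_joins ->.
(* Two orbits of an involution coincide as soon as they share a point, here [inr (e y)]. *)
have memK y f c : sigma (inr f) = c ->
    (K y == [set inr f; c]) = (e y == f) || (c == inr (e y)).
  move=> fc; apply/idP/idP => [/eqP/setP/(_ (inr (e y)))|].
    by rewrite !inE eqxx /= => /esym/orP[/eqP[->]|/eqP->]; rewrite eqxx ?orbT.
  case/orP=> /eqP yE; first by rewrite /K yE fc.
  by rewrite /K -yE -fc sigmaK setUC.
exists (preim_partition K [set: vertex G]); split.
- exact: preim_partitionP.
- move=> v w vw; have [f fvw] := edge_of_adj vw.
  have Kvw : K v = K w by rewrite (Kend _ _ _ fvw) -(Kend f w v) // joinsC.
  have [/eqP cov triv _] := and3P (preim_partitionP K [set: vertex G]).
  apply/esym/same_pblock => //.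
  by rewrite pblock_equivalence_partition ?inE ?Kvw //= => [x y z _ _ _]; split=> // /eqP->.
move=> _ /imsetP[x _ ->]; set B := [set y in _ | _].
have memB y : y \in B = (e y == e x) || (sigma (inr (e x)) == inr (e y)).
  by rewrite !inE /= eq_sym (memK _ _ _ erefl).
have joins_sigma f v w : joins f v w -> sigma (inl v) = inl w /\ sigma (inl w) = inl v.
  by move=> fvw; split; apply/eqP; rewrite -adj_sigma (joins_adj (f := f)) // joinsC.
have e_cases y f v w : joins f v w ->
    (e y == f) = (y \in [:: v; w]) || (sigma (inr f) == inl y).
  move=> fvw; apply/eqP/idP => [ey|].
    have := eP y; rewrite ey => -[<-|[z _ fyz]]; first by rewrite sigmaK eqxx orbT.
    by rewrite !inE (joins_mem fvw fyz).
  case/orP=> [|/eqP fy]; last by apply: e_vertex; rewrite -fy sigmaK.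
  by rewrite !inE => /orP[] /eqP->; [|rewrite joinsC in fvw]; apply: e_joins fvw.
have [v [w fvw]] := exists_joins (e x).
clearbody B; move: (e x) fvw memB => f fvw memB {x}.
have [sv sw] := joins_sigma _ _ _ fvw.
have vNw : v != w by apply: contraTneq (joins_adj fvw) => ->; rewrite adj_irr.
(* The block consists of the ends of [f] together with either the vertex [u] (type A_2) or the ends
   of a second edge [f'] (type A_3). *)
case fc: (sigma (inr f)) => [u|f'] in memB.
- have su : sigma (inl u) = inr f by rewrite -fc sigmaK.
  have uNv : u != v by apply: contra_eq_neq su => ->; rewrite sv.
  have uNw : u != w by apply: contra_eq_neq su => ->; rewrite sw.
  have uniq3 : uniq [:: v; w; u].
    by rewrite /= !inE negb_or vNw !(eq_sym _ u) uNv uNw.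
  apply: Or32; apply: (@induces_copy_seq _ _ _ v [:: v; w; u]) => //.
  + move=> y; rewrite memB orbF (e_cases _ _ _ _ fvw) fc !inE.
    by rewrite [inl u == _]eq_sym orbA.
  (* Adjacency compares the mate of entry i with entry j. The mate of [u] is an edge, so [u] is
     isolated in the block. *)
  + have nthE := inl_nth_eq v uniq3.
    move=> [[|[|[|//]]] ?] j; rewrite adj_sigma /= ?sv ?sw ?su.
    * by rewrite (nthE 1%N (nat_of_ord j)) //; case: j => [[|[|[|//]]] ?].
    * by rewrite (nthE 0%N (nat_of_ord j)) //; case: j => [[|[|[|//]]] ?].
    * by case: j => [[|[|[|//]]] ?].
- have f'c : sigma (inr f') = inr f by rewrite -fc sigmaK.
  have fNf' : f' != f.
    by apply: contraNneq (sigma_neq (inr f)) => f'E; rewrite fc f'E.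
  have [v' [w' fvw']] := exists_joins f'.
  have [sv' sw'] := joins_sigma _ _ _ fvw'.
  have vNw' : v' != w' by apply: contraTneq (joins_adj fvw') => ->; rewrite adj_irr.
  (* A vertex common to both edges would have [f] and [f'] as its one assigned edge. *)
  have disj y z : y \in [:: v; w] -> z \in [:: v'; w'] -> y != z.
    move=> yf zf'; apply: contraNneq fNf' => yz.
    have /eqP <- : e y == f by rewrite (e_cases _ _ _ _ fvw) yf.
    have /eqP <- : e z == f' by rewrite (e_cases _ _ _ _ fvw') zf'.
    by rewrite yz.
  have uniq4 : uniq [:: v; w; v'; w'].
    by rewrite /= !inE !negb_or vNw vNw' !disj // !inE eqxx ?orbT.
  apply: Or33; apply: (@induces_copy_seq _ _ _ v [:: v; w; v'; w']) => //.
  + move=> y; rewrite memB (inj_eq (@inr_inj _ _)) [f' == _]eq_sym.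
    rewrite (e_cases _ _ _ _ fvw) (e_cases _ _ _ _ fvw') fc f'c !inE.
    by rewrite !(orbF (_ || _)) -orbA.
  + have nthE := inl_nth_eq v uniq4.
    move=> [[|[|[|[|//]]]] ?] j; rewrite adj_sigma /= ?sv ?sw ?sv' ?sw'.
    * by rewrite (nthE 1%N (nat_of_ord j)) //; case: j => [[|[|[|[|//]]]] ?].
    * by rewrite (nthE 0%N (nat_of_ord j)) //; case: j => [[|[|[|[|//]]]] ?].
    * by rewrite (nthE 3%N (nat_of_ord j)) //; case: j => [[|[|[|[|//]]]] ?].
    * by rewrite (nthE 2%N (nat_of_ord j)) //; case: j => [[|[|[|[|//]]]] ?].
Qed.

End Basic.

Lemma adapted_girth3 : complex_structure J -> pieces_A1 J = set0 -> ~ basic G ->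
  girth G = Some 3%N.
Proof.
move=> cJ A1 nbasic.
have [[v [w [vw svw]]]|dist] :=
    pselect (exists v w : vertex G, adj v w /\ sigma (inl v) != inl w).
  have [[v' vv' v'w]|[w' ww' vw']] := sigma_adj cJ vw svw.
    have a := pieces_A1_eq0 A1 vv'.
    by apply: (triangle_girth a v'w); rewrite adj_sym.
  have a := pieces_A1_eq0 A1 ww'.
  by apply: (triangle_girth vw a); rewrite adj_sym.
(* Adjacent vertices are now always mates; conversely mates are adjacent because there is no A_1
   piece. *)
case: nbasic; apply: all_distinguished_basic => v w.
apply/idP/eqP => [vw|]; last exact: pieces_A1_eq0.
by apply: contra_notP dist => /eqP svw; exists v, w.
Qed.

End SignedPermutationTheory.

(** Once the cycle is rotated to start at [x], the neighbours are its second and last entries,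
    distinct since the length exceeds 2. *)
Lemma cycle_two_neighbours (T : eqType) (e : rel T) (c : seq T) (x : T) :
  symmetric e -> (2 < size c)%N -> ucycleb e c -> x \in c ->
  exists y z, [/\ y \in c, z \in c, y != z, e x y & e x z].
Proof.
move=> esym c2 /andP[cyc uc] /rot_to[i s rE].
have : uniq (x :: s) by rewrite -rE rot_uniq.
have : cycle e (x :: s) by rewrite -rE rot_cycle.
have : (2 < size (x :: s))%N by rewrite -rE size_rot.
have memE : c =i x :: s by move=> y; rewrite -rE mem_rot.
case: s {rE} memE => [|y s] // memE; case: (lastP s) memE => [|{}s z] memE //= _.
rewrite rcons_path last_rcons (esym z x) => /and3P[xy _ xz] /and3P[_ yNs _].
exists y, z; rewrite !memE !inE !mem_rcons !inE !eqxx ?orbT; split=> //.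
by apply: contraNneq yNs => ->; rewrite mem_rcons inE eqxx.
Qed.

(** * The graph of girth n: a cycle with pendant vertices *)

Section SunGraph.
Variable m : nat.
Notation n := m.+3.
Notation N := m.*2.+2.+4.

(* Vertex [2 i] is the i-th vertex v_i of an n-cycle and [2 i + 1] the pendant
   vertex w_i, attached to v_(i-1); with this interleaved numbering [v_i, v_(i+1)]
   and [v_i, w_(i+1)] carry the same sign, even for i = n - 1. *)
Definition arc (p q : nat) : bool :=
  ~~ odd p && ((q./2 == p./2.+1) || (p./2.+1 == n) && (q./2 == 0)).

Definition sun_adj : rel 'I_N := fun p q => arc p q || arc q p.

Lemma sun_adj_sym : symmetric sun_adj.
Proof. by move=> p q; rewrite /sun_adj orbC. Qed.

Lemma sun_adj_irr : irreflexive sun_adj.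
Proof. by move=> p; rewrite /sun_adj /arc; lia. Qed.

Definition sun : sgraph := SGraph sun_adj_sym sun_adj_irr.

(** Exchanges v_i and w_i. *)
Definition tau (p : nat) : nat := if odd p then p.-1 else p.+1.

Lemma tauK : involutive tau.
Proof.
move=> p; rewrite /tau; have [po|pe] := boolP (odd p).
  by case: p po => //= p /negbTE ->.
by rewrite /= pe.
Qed.

Lemma odd_tau p : odd (tau p) = ~~ odd p.
Proof. by rewrite /tau; case: ifP => ?; lia. Qed.

Lemma half_tau p : (tau p)./2 = p./2.
Proof. by rewrite /tau; case: ifP => ?; lia. Qed.

Lemma tau_lt (p : 'I_N) : (tau p < N)%N.
Proof. by have := ltn_ord p; rewrite /tau; case: ifP => ?; lia. Qed.

Definition vtau (p : vertex sun) : vertex sun := Ordinal (tau_lt p).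

Lemma vtauK : involutive vtau.
Proof. by move=> p; apply: val_inj; rewrite /= tauK. Qed.

(** Moves the head of the arc to its mate. An edge is stored with increasing indices, so its arc may
    run in either direction along the pair. *)
Definition swap_leaf (f : vertex sun * vertex sun) : vertex sun * vertex sun :=
  if arc f.1 f.2 then (f.1, vtau f.2) else (vtau f.1, f.2).

Lemma arc_tau p q : arc p (tau q) = arc p q.
Proof. by rewrite /arc half_tau. Qed.

(** Opposite arcs would give i = i + 2 modulo n, impossible for n >= 3. *)
Lemma arc_asym (p q : 'I_N) : arc p q -> ~~ arc q p.
Proof. by have := ltn_ord p; have := ltn_ord q; rewrite /arc; lia. Qed.

(** The ends of an arc have different halves, which alone decide their order, and [tau] preserves
    halves. Hence [swap_leaf] keeps the stored pair increasing. *)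
Lemma arc_tau_lt p q : arc p q -> (p < tau q)%N = (p < q)%N /\ (tau q < p)%N = (q < p)%N.
Proof. by have := half_tau q; rewrite /arc; lia. Qed.

Lemma swap_leaf_arc (p q : vertex sun) : arc p q -> swap_leaf (p, q) = (p, vtau q).
Proof. by rewrite /swap_leaf /= => ->. Qed.

Lemma swap_leaf_rev (p q : vertex sun) : arc q p -> swap_leaf (p, q) = (vtau p, q).
Proof. by move=> /arc_asym/negbTE; rewrite /swap_leaf /= => ->. Qed.

Lemma is_edge_swap_leaf f : is_edge f -> is_edge (swap_leaf f).
Proof.
case: f => p q /andP[/= pq /orP[] a].
  by rewrite swap_leaf_arc // /is_edge /= /sun_adj (arc_tau_lt a).1 pq arc_tau a.
by rewrite swap_leaf_rev // /is_edge /= /sun_adj (arc_tau_lt a).2 pq arc_tau a orbT.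
Qed.

Lemma swap_leafK f : is_edge f -> swap_leaf (swap_leaf f) = f.
Proof.
case: f => p q /andP[_ /orP[] /= a].
  by rewrite !swap_leaf_arc /= ?arc_tau // vtauK.
by rewrite !swap_leaf_rev /= ?arc_tau // vtauK.
Qed.

Definition sun_edge_sigma (f : edge sun) : edge sun :=
  exist _ (swap_leaf (val f)) (is_edge_swap_leaf (valP f)).

Definition sun_sigma (b : basis_index sun) : basis_index sun :=
  match b with inl p => inl (vtau p) | inr f => inr (sun_edge_sigma f) end.

(** The head of the arc, that is, the end moved by [swap_leaf]; it may be a pendant vertex or lie on
    the n-cycle. *)
Definition leaf (f : vertex sun * vertex sun) : nat :=
  if arc f.1 f.2 then f.2 else f.1.

Lemma leaf_arc (p q : vertex sun) : arc p q -> leaf (p, q) = q.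
Proof. by rewrite /leaf /= => ->. Qed.

Lemma leaf_rev (p q : vertex sun) : arc q p -> leaf (p, q) = p.
Proof. by move=> /arc_asym/negbTE; rewrite /leaf /= => ->. Qed.

(** The minus sign sits on the output coordinates of v_i and of arcs ending at some v_i, so J v_i =
    w_i and J w_i = - v_i. *)
Definition sun_sign (b : basis_index sun) : bool :=
  match b with inl p => ~~ odd p | inr f => ~~ odd (leaf (val f)) end.

Lemma sun_sigmaK : involutive sun_sigma.
Proof.
move=> [p|f] /=; first by rewrite vtauK.
by congr inr; apply: val_inj; rewrite /= swap_leafK // (valP f).
Qed.

Lemma sun_signK b : sun_sign (sun_sigma b) = ~~ sun_sign b.
Proof.
case: b => [p|[[p q] /= pq]] /=; first by rewrite odd_tau.
case/andP: pq => _ /orP[] /= a.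
  by rewrite swap_leaf_arc // !leaf_arc //= ?arc_tau // odd_tau.
by rewrite swap_leaf_rev // !leaf_rev //= ?arc_tau // odd_tau.
Qed.

(** * The complex structure and its basic subgraph *)

Definition sunJ (R : realType) : {linear lie R sun -> lie R sun} :=
  signed_perm sun_sigma sun_sign.

(** Along the arcs out of v_i the bracket is B(x, y) - B(y, x) with B(x, J y) = J B(x, y). For a
    form that is J-linear in one argument, the four terms of the integrability condition cancel. *)
Lemma sunJ_adapted (R : realType) : adapted_complex_structure (sunJ R).
Proof.
split; last first.
  move=> a; exists (sun_sigma a); rewrite /= signed_perm_bvec; last exact: sun_sigmaK.
  by case: (sun_sign _); rewrite ?scale1r ?scaleN1r ?opprK; [right|left].
split=> [x|x y]; first exact: signed_permK sun_sigmaK sun_signK _.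
apply/ffunP => -[v|f]; rewrite !ffunE /=.
  by rewrite !bracket_inl addr0 mulr0 addr0 subr0.
rewrite !bracket_inr /= !ffunE /=.
case: f => [[p q] /= /andP[_ /orP[] /= a]].
  rewrite swap_leaf_arc // leaf_arc //= vtauK odd_tau.
  (* The tail of an arc is even, so only the parity of the head remains to be split. *)
  by have /andP[/negbTE-> _] := a; case: (odd q) => /=; ring.
rewrite swap_leaf_rev // leaf_rev //= vtauK odd_tau.
by have /andP[/negbTE-> _] := a; case: (odd p) => /=; ring.
Qed.

Lemma sun_not_adj_vtau (p : vertex sun) : ~~ adj p (vtau p).
Proof. by rewrite /= /sun_adj /arc /= half_tau; lia. Qed.

(** J v is the mate of v up to sign; mates share their half, whereas adjacent vertices do not. So
    neither A_2 nor A_3 can occur. *)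
Lemma sun_not_distinguished (R : realType) (v w : vertex sun) (f : edge sun) :
  joins f v w -> vvec R w != sunJ R (vvec R v).
Proof.
move=> fvw; apply/eqP => vw.
have [wE] : inl (vtau v) = inl w :> basis_index sun.
  exact: (sigma_of_J (J := sunJ R) sun_sigmaK (fun x => erefl _) vw).
by have := sun_not_adj_vtau v; rewrite wE (joins_adj fvw).
Qed.

Lemma sun_pieces_A2 (R : realType) : pieces_A2 (sunJ R) = set0.
Proof.
apply/setP => B; rewrite !inE; apply/idP.
case/existsP=> v /existsP[w /existsP[u /existsP[f /and5P[_ _ fvw vw _]]]].
by have := sun_not_distinguished R fvw; rewrite vw.
Qed.

Lemma sun_pieces_A3 (R : realType) : pieces_A3 (sunJ R) = set0.
Proof.
apply/setP => B; rewrite !inE; apply/idP.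
case/existsP=> v /existsP[w /existsP[v' /existsP[w' /existsP[f /existsP[f']]]]].
case/and5P=> _ _ /andP[fvw vw] _ _.
by have := sun_not_distinguished R fvw; rewrite vw.
Qed.

(** * Connectedness and girth of the sun graph *)

Lemma sun_connected : gconnected sun.
Proof.
split=> //; have csym := sym_connect_sym sun_adj_sym.
suff c0 (v : 'I_N) : connect sun_adj ord0 v.
  by move=> v w; apply: connect_trans (c0 w); rewrite csym.
(* Apart from v_0 and w_0, each v_i or w_i is adjacent to v_(i-1), which has a smaller number.
   Vertex 1 is w_0, whose only neighbour v_(n-1) has a larger one. *)
have c0_neq1 : forall k (v : 'I_N), (v < k)%N -> v != 1%N :> nat -> connect sun_adj ord0 v.
  elim=> // k IH {}v vk v1; have [v0|v2] : (v = 0 :> nat \/ 1 < v)%N by lia.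
    by have -> : v = ord0 by exact: val_inj.
  have uN : ((v./2.-1).*2 < N)%N by have := ltn_ord v; lia.
  apply: (@connect_trans _ _ (Ordinal uN)); first by apply: IH => /=; lia.
  by apply: connect1; rewrite /sun_adj /arc /=; lia.
have [v1|] := eqVneq (v : nat) 1%N; last exact: c0_neq1 (ltnSn _).
(* The number 2m + 4 = 2(n - 1) is that of v_(n-1). *)
have uN : (m.*2.+4 < N)%N by lia.
apply: (@connect_trans _ _ (Ordinal uN)); first by apply: c0_neq1 (ltnSn _) _.
by apply: connect1; rewrite /sun_adj /arc /=; lia.
Qed.

Definition rim (i : nat) : 'I_N := inord i.*2.

Lemma val_rim i : (i < n)%N -> rim i = i.*2 :> nat.
Proof. by move=> ilt; rewrite inordK //; lia. Qed.

Lemma uniq_rim : uniq [seq rim i | i <- iota 0 n].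
Proof.
rewrite map_inj_in_uniq ?iota_uniq // => i j; rewrite !mem_iota => /andP[_ ilt] /andP[_ jlt].
by move=> /(congr1 (@nat_of_ord _)); rewrite !val_rim //; lia.
Qed.

Lemma sun_has_cycle : has_cycle sun n.
Proof.
have szc : size [seq rim i | i <- iota 0 n] == n by rewrite size_map size_iota.
apply/existsP; exists (Tuple szc); apply/andP; split=> //; apply/andP; split; last exact: uniq_rim.
suff: path sun_adj (rim 0) (rcons [seq rim i | i <- iota 1 m.+2] (rim 0)) by [].
apply/(pathP ord0) => i.
rewrite size_rcons size_map size_iota => ilt.
have -> : nth ord0 (rim 0 :: rcons [seq rim i | i <- iota 1 m.+2] (rim 0)) i = rim i.
  case: i ilt => // i ilt.
  rewrite -[LHS]/(nth ord0 (rcons [seq rim i | i <- iota 1 m.+2] (rim 0)) i).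
  rewrite nth_rcons size_map size_iota.
  by rewrite ltnS in ilt; rewrite ilt (nth_map 0%N) ?size_iota // nth_iota.
(* The entry following v_i is v_(i+1), except that the last one wraps around to v_0. *)
have -> : nth ord0 (rcons [seq rim i | i <- iota 1 m.+2] (rim 0)) i =
    rim (if i == m.+2 then 0%N else i.+1).
  rewrite nth_rcons size_map size_iota; have [->|iN] := eqVneq i m.+2; first by rewrite ltnn.
  have -> : (i < m.+2)%N by lia.
  by rewrite (nth_map 0%N) ?size_iota ?nth_iota //; lia.
rewrite /= /sun_adj /arc !val_rim //; last by case: ifP; lia.
case: ifP; lia.
Qed.

(** Each vertex of a cycle has two neighbours on it. This excludes the pendant vertices, and then
    forces v_(i+1) into the cycle along with v_i, so all n of the v_i occur. *)
Lemma sun_cycle_ge k : has_cycle sun k -> (n <= k)%N.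
Proof.
case/existsP=> c /andP[k2 cyc]; have sz := size_tuple c; rewrite -[k]sz in k2 *.
have nbrs x : x \in tval c -> exists y z : 'I_N,
    [/\ y \in tval c, z \in tval c, y != z :> nat, sun_adj x y & sun_adj x z].
  exact: cycle_two_neighbours sun_adj_sym k2 cyc.
have c_even (x : 'I_N) : x \in tval c -> ~~ odd x.
  move=> /nbrs[y [z [_ _ yz xy xz]]]; have := ltn_ord x; have := ltn_ord y; have := ltn_ord z.
  by move: xy xz yz; rewrite /sun_adj /arc; lia.
have step i j : (i < n)%N -> (j < n)%N -> (j == i.+1) || (i == m.+2) && (j == 0%N) ->
    rim i \in tval c -> rim j \in tval c.
  move=> ilt jlt ij /nbrs[y [z [yc zc yz xy xz]]].
  have yE := c_even _ yc; have zE := c_even _ zc; have yN := ltn_ord y; have zN := ltn_ord z.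
  (* The only even neighbours of v_i are v_(i-1) and v_(i+1), so the distinct [y] and [z] are these
     two. *)
  have : (y == rim j :> nat) || (z == rim j :> nat).
    move: xy xz; rewrite /sun_adj /arc !val_rim //; lia.
  by case/orP => /eqP/val_inj <-.
have up i j : (i <= j)%N -> (j < n)%N -> rim i \in tval c -> rim j \in tval c.
  elim: j => [|j IH]; first by case: i.
  rewrite leq_eqVlt => /orP[/eqP-> //|ij] jlt ic.
  by apply: (@step j) => //; [lia|rewrite eqxx|apply: IH => //; lia].
have [x xc] : exists x : 'I_N, x \in tval c.
  by case: (tval c) k2 => // x s _; exists x; rewrite inE eqxx.
have xlt : (x./2 < n)%N by have := ltn_ord x; lia.
have xE : rim x./2 = x.
  by apply: val_inj; rewrite /= val_rim //; have := c_even _ xc; lia.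
(* Climb from [x] to v_(n-1), then wrap around to v_0. *)
have c0 : rim 0 \in tval c.
  apply: (@step m.+2) => //; first by rewrite eqxx orbT.
  by apply: (@up x./2); rewrite ?xE.
rewrite -[X in (X <= _)%N](size_iota 0) -(size_map rim).
apply: uniq_leq_size uniq_rim _ => _ /mapP[i + ->]; rewrite mem_iota => /andP[_ ilt].
exact: (@up 0%N).
Qed.

Lemma girth_sun : girth sun = Some n.
Proof. exact: girth_eq sun_has_cycle sun_cycle_ge. Qed.

End SunGraph.

Local Close Scope ring_scope.

Theorem proposition6p12 (R : realType) :
  (forall (G : sgraph) (J : {linear lie R G -> lie R G}) (p1 p2 p3 : nat),
     adapted_complex_structure J ->
     basic_subgraph_type J = (p1, p2, p3) ->
     p1 = 0%N ->
     ~ basic G ->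
     girth G = Some 3)
  /\
  (forall n : nat, (3 <= n)%N ->
     exists (G : sgraph) (J : {linear lie R G -> lie R G}) (p1 p2 p3 : nat),
       [/\ gconnected G,
           adapted_complex_structure J,
           basic_subgraph_type J = (p1, p2, p3),
           p2 = 0%N /\ p3 = 0%N
         & girth G = Some n]).
Proof.
split=> [G J p1 p2 p3 adJ [A1 _ _] p10 nbasic|[|[|[|m]]] // _].
  have [sigma [s [sigmaK sK JE]]] := adapted_signed_perm adJ.
  have [cJ _] := adJ; apply: (adapted_girth3 sigmaK sK JE cJ) nbasic.
  by apply/eqP; rewrite -cards_eq0 A1 p10.
exists (sun m), (sunJ m R), #|pieces_A1 (sunJ m R)|, 0%N, 0%N; split=> //.
- exact: sun_connected.
- exact: sunJ_adapted.
- by rewrite /basic_subgraph_type sun_pieces_A2 sun_pieces_A3 cards0.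
- exact: girth_sun.
Qed.
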